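(* Let $\Gamma$ be an infinite Abelian group which is not a torsion group, and let $T$ be a tree of diameter $5$ whose central vertices $v_{c_1}$ and $v_{c_2}$ both lie in $\Omega_{\mathfrak{s}}(T)\cup\Omega_{\mathfrak{w}}(T)$. Then $T$ is $\Gamma$-vertex magic if and only if $T$ has no vertex of degree $2$.
   Context: Graphs are finite, simple and undirected. For an additive Abelian group $\Gamma$ with identity $0$ and a graph $G$, a $\Gamma$-vertex magic labeling is a map $\ell:V(G)\to\Gamma\setminus\{0\}$ for which there is $\mu\in\Gamma$ with $w(v)=\sum_{u\in N(v)}\ell(u)=\mu$ for every vertex $v$; $G$ is $\Gamma$-vertex magic if it has such a labeling. A pendant vertex has degree $1$. $\Omega_{\mathfrak{s}}(T)$ is the set of strong support vertices (adjacent to at least two pendant vertices) and $\Omega_{\mathfrak{w}}(T)$ the set of weak support vertices (adjacent to exactly one pendant vertex). A tree of diameter $5$ has two adjacent central vertices $v_{c_1},v_{c_2}$, the two middle vertices of any longest path. A torsion group is one all of whose elements have finite order. *)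

(* Defs.v *)
From mathcomp Require Import all_boot all_algebra.

Set Implicit Arguments.
Unset Strict Implicit.
Unset Printing Implicit Defensive.

Import GRing.Theory.

(* A graph is a finite vertex type V with a symmetric and irreflexive adjacency
   relation e (see [simple_graph]). *)

Definition simple_graph (V : finType) (e : rel V) : Prop :=
  symmetric e /\ irreflexive e.

Definition neighbours (V : finType) (e : rel V) (v : V) : {set V} :=
  [set u | e v u].

Definition degree (V : finType) (e : rel V) (v : V) : nat :=
  #|neighbours e v|.

Definition pendant (V : finType) (e : rel V) (v : V) : bool :=
  degree e v == 1.

Definition pendant_neighbours (V : finType) (e : rel V) (v : V) : {set V} :=
  [set u in neighbours e v | pendant e u].

Definition strong_support (V : finType) (e : rel V) : {set V} :=
  [set v | 2 <= #|pendant_neighbours e v|].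

Definition weak_support (V : finType) (e : rel V) : {set V} :=
  [set v | #|pendant_neighbours e v| == 1].

Definition connected_graph (V : finType) (e : rel V) : Prop :=
  0 < #|V| /\ forall x y : V, connect e x y.

(* In a symmetric relation an edge traversed back and forth is a [ucycle] of
   size 2, so a graph cycle is a [ucycle] of size at least 3. *)
Definition acyclic_graph (V : finType) (e : rel V) : Prop :=
  forall c : seq V, ucycle e c -> size c <= 2.

Definition tree (V : finType) (e : rel V) : Prop :=
  [/\ simple_graph e, connected_graph e & acyclic_graph e].

Definition has_walk (V : finType) (e : rel V) (x y : V) (n : nat) : bool :=
  [exists p : n.-tuple V, path e x p && (last x p == y)].

(* The least length of a walk from x to y, which is less than #|V| when y is
   reachable from x; the value is #|V| when it is not. *)
Definition dist (V : finType) (e : rel V) (x y : V) : nat :=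
  find (has_walk e x y) (iota 0 #|V|).

Definition diameter (V : finType) (e : rel V) : nat :=
  \max_(x : V) \max_(y : V) dist e x y.

Definition simple_path (V : finType) (e : rel V) (s : seq V) : bool :=
  sorted e s && uniq s.

Definition longest_path (V : finType) (e : rel V) (s : seq V) : Prop :=
  simple_path e s /\ forall t : seq V, simple_path e t -> size t <= size s.

(* The longest paths of a tree of odd diameter all have the same two middle
   vertices, so asking for one such path determines c1 and c2 up to order. *)
Definition central_pair (V : finType) (e : rel V) (c1 c2 : V) : Prop :=
  exists s1 s2 : seq V,
    size s1 = size s2 /\ longest_path e (s1 ++ c1 :: c2 :: s2).

Local Open Scope ring_scope.

Definition weight (Gamma : zmodType) (V : finType) (e : rel V)
    (l : V -> Gamma) (v : V) : Gamma :=
  \sum_(u in neighbours e v) l u.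

Definition vertex_magic_labeling (Gamma : zmodType) (V : finType) (e : rel V)
    (l : V -> Gamma) : Prop :=
  (forall v, l v != 0) /\ exists mu : Gamma, forall v, weight e l v = mu.

Definition vertex_magic (Gamma : zmodType) (V : finType) (e : rel V) : Prop :=
  exists l : V -> Gamma, vertex_magic_labeling e l.

Definition torsion_group (Gamma : zmodType) : Prop :=
  forall x : Gamma, exists2 n : nat, (0 < n)%N & x *+ n = 0.

Definition infinite_group (Gamma : zmodType) : Prop :=
  ~ exists s : seq Gamma, forall x, x \in s.

(* Main.v *)
(* Every non-pendant vertex of T is a support vertex: otherwise T would have
   a simple path on more than 6 vertices. In a magic labeling the pendant
   vertices then force the label mu on all non-pendant vertices, so that the
   pendant neighbour of a vertex of degree 2 would be labelled 0. Conversely,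
   if g has infinite order, give every non-pendant vertex the label g; if n
   neighbours of v are not pendant, its pendant neighbours must have labels
   of sum (1 - n) g. Nonzero multiples of g with this sum exist unless v has
   a single pendant neighbour and n = 1, that is, unless v has degree 2. *)
Require Import Defs.
From mathcomp Require Import all_boot all_algebra zify.
From Stdlib Require Import Classical.

Set Implicit Arguments.
Unset Strict Implicit.
Unset Printing Implicit Defensive.

Import GRing.Theory.

(** * Simple paths in acyclic graphs *)

Section Trees.

Variables (V : finType) (e : rel V).
Hypothesis (e_sym : symmetric e) (e_irr : irreflexive e).
Hypothesis e_acyclic : acyclic_graph e.

(** A local condition, hence easy to check for glued walks; for a walk in an acyclic graph it
    already forces distinct vertices. *)
Fixpoint nonbacktracking (s : seq V) : bool :=
  match s with
  | x :: ((_ :: z :: _) as t) => (x != z) && nonbacktracking t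
  | _ => true
  end.

Lemma uniq_nonbacktracking s : uniq s -> nonbacktracking s.
Proof.
elim: s => [|x [|y [|z s]] IH] //; rewrite cons_uniq => /andP[xN u].
apply/andP; split; last exact: IH.
by apply: contraNneq xN => ->; rewrite !inE eqxx orbT.
Qed.

(** The two pieces overlap in [x, y], so any three consecutive vertices lie in one of them. *)
Lemma nonbacktracking_cat s x y t :
  nonbacktracking (s ++ [:: x; y]) -> nonbacktracking [:: x, y & t] ->
  nonbacktracking (s ++ [:: x, y & t]).
Proof.
elim: s => [|a [|b [|c s]] IH] //=.
- by move=> /andP[-> _] ->.
- by move=> /andP[-> /andP[-> _]] ->.
by move=> /andP[-> h] h'; apply: IH.
Qed.

Lemma nonbacktracking_uniq x p :
  path e x p -> nonbacktracking (x :: p) -> uniq (x :: p).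
Proof.
elim: p x => [|a p IH] x //= /andP[xa ep] nb.
have nb' : nonbacktracking (a :: p) by case: (p) nb => //= b p' /andP[].
have /= u := IH a ep nb'; rewrite u andbT.
apply/negP; rewrite inE => /orP[/eqP xE|xp]; first by rewrite xE e_irr in xa.
case/splitPr: xp ep u nb nb' {IH} => r q.
rewrite cat_path /= mem_cat inE cat_uniq /= => /and3P[er rx _].
rewrite !negb_or => /andP[/and3P[aNr aNx _] /and3P[ur /andP[xNr _] _]].
(* The tail has no repetition, so a return to [x] after [r] closes a cycle through [x], [a] and [r];
   an empty [r] would be a backtrack. *)
case: r er rx aNr ur xNr => [|b r] er rx aNr ur xNr; first by rewrite /= eqxx.
move=> _ _; suff /e_acyclic : ucycle e [:: x, a, b & r] by [].
apply/andP; split.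
  by move: er => /= /andP[ab er]; rewrite rcons_path xa ab er.
by rewrite /= in ur *; rewrite inE negb_or eq_sym aNx xNr aNr.
Qed.

(** Otherwise the walk from [a] to [b], made simple, closes up through [x] to a cycle of size at
    least 3. *)
Lemma acyclic_no_detour x a b r :
  e x a -> e x b -> path e a r -> last a r = b -> x \notin a :: r -> a = b.
Proof.
move=> xa xb /shortenP[r' er u sub] lr xN.
case: r' er u lr sub => [|c r'] er u lr sub; first by [].
suff /e_acyclic : ucycle e [:: x, a, c & r'] by [].
apply/andP; split.
  by move: er lr => /= /andP[ac er] lr; rewrite rcons_path xa ac er lr e_sym.
rewrite cons_uniq u andbT; apply: contra xN.
by rewrite in_cons => /predU1P[->|/sub xr]; rewrite in_cons ?eqxx // xr orbT.
Qed.

Lemma acyclic_path_unique x p q :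
  path e x p -> path e x q -> uniq (x :: p) -> uniq (x :: q) ->
  last x p = last x q -> p = q.
Proof.
elim: p x q => [|a p IH] x [|b q] //.
- by move=> _ _ _ /= /andP[xN _] lx; rewrite lx mem_last in xN.
- by move=> _ _ /= /andP[xN _] _ lx; rewrite -lx mem_last in xN.
move=> /= /andP[xa ep] /andP[xb eq] /andP[xNp up] /andP[xNq uq] lpq.
suff ab : a = b by rewrite -ab in eq uq lpq *; rewrite (IH a q).
(* Go from [a] along [p] to the common end, then back along [q] to [b]; neither part meets [x]. *)
apply: (@acyclic_no_detour x a b (p ++ rev (belast b q))) => //.
- rewrite cat_path ep lpq /= rev_path.
  by rewrite (eq_path (e' := e)) // => u v; apply: e_sym.
- rewrite last_cat lpq; case: (q) => [//|c q'] /=.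
  by rewrite rev_cons last_rcons.
rewrite -cat_cons mem_cat negb_or xNp /= mem_rev.
by apply: contra xNq => /mem_belast.
Qed.

Lemma simple_path_size_dist x p :
  path e x p -> uniq (x :: p) -> size p <= dist e x (last x p).
Proof.
(* A distance below [size p] is then not the default [#|V|], so a walk attains it; made simple, this
   walk is [p] itself, which is too long. *)
move=> ep up; have sp : size p < #|V|.
  by have := max_card (mem (x :: p)); rewrite (card_uniqP up).
rewrite /dist leqNgt; apply/negP => lt.
have: has (has_walk e x (last x p)) (iota 0 #|V|).
  by rewrite has_find size_iota (ltn_trans lt).
move/(nth_find 0); rewrite nth_iota ?(ltn_trans lt) // add0n.
case/existsP => -[q /= /eqP sq] /andP[eq /eqP].
case/shortenP: eq => q' eq' uq' /(uniq_leq_size (proj2 (andP uq'))) sub lq.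
by rewrite -sq (acyclic_path_unique ep eq' up uq') // ltnNge sub in lt.
Qed.

Lemma simple_path_size_diameter s :
  simple_path e s -> size s <= (diameter e).+1.
Proof.
case: s => [//|x p] /andP[ep up].
rewrite ltnS (leq_trans (simple_path_size_dist ep up)) //.
rewrite /diameter (leq_trans _ (leq_bigmax x)) //.
exact: (leq_bigmax (F := fun y => dist e x y)).
Qed.

End Trees.

(** * Connectedness and pendant vertices *)

Lemma diameter_le_card (V : finType) (e : rel V) : diameter e <= #|V|.
Proof.
apply/bigmax_leqP => x _; apply/bigmax_leqP => y _.
by rewrite /dist (leq_trans (find_size _ _)) // size_iota.
Qed.

(** A nonempty set closed under adjacency is everything; applied to sets of two or three vertices,
    this contradicts lower bounds on [#|V|]. *)
Lemma connected_closed_card (V : finType) (e : rel V) (A : {set V}) a :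
  symmetric e -> connected_graph e -> a \in A ->
  (forall x y, e x y -> x \in A -> y \in A) -> #|V| <= #|A|.
Proof.
move=> e_sym [_ conn] aA clA; apply/subset_leq_card/subsetP => y _.
rewrite -(closed_connect _ (conn a y)) //.
by apply: intro_closed => //; apply: sym_connect_sym.
Qed.

Lemma other_neighbour (V : finType) (e : rel V) v h :
  ~~ pendant e v -> e v h -> exists2 u, e v u & u != h.
Proof.
move=> vN vh; have h_in : h \in neighbours e v by rewrite inE.
have : 1 < degree e v.
  by rewrite ltn_neqAle eq_sym vN /degree; apply/card_gt0P; exists h.
rewrite /degree (cardsD1 h) h_in => /card_gt0P[u].
by rewrite !inE => /andP[uh vu]; exists u.
Qed.

Lemma neighbours_pendant (V : finType) (e : rel V) u v :
  pendant e u -> e u v -> neighbours e u = [set v].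
Proof.
case/cards1P => w Nu uv; have : v \in neighbours e u by rewrite inE.
by rewrite Nu inE => /eqP->.
Qed.

(** * Support vertices in a tree of diameter 5 *)

Lemma support_pendant_neighbour (V : finType) (e : rel V) c :
  c \in strong_support e :|: weak_support e ->
  exists2 u, e c u & pendant e u.
Proof.
rewrite !inE => cs; have /card_gt0P[u] : 0 < #|pendant_neighbours e c| by lia.
by rewrite !inE => /andP[]; exists u.
Qed.

(* If all neighbours of [v] were non-pendant, the path from [v] to [c1] could be
   prolonged by two vertices before [v] and by [c2 :: s] after [c1]. *)
Lemma support_of_path_to_edge (V : finType) (e : rel V) c1 c2 v p s :
  tree e -> (forall t, simple_path e t -> size t < size s + 5) ->
  path e v (rcons p c1) ->
  uniq (v :: rcons p c1) -> c2 \notin v :: rcons p c1 ->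
  path e c1 (c2 :: s) -> uniq [:: c1, c2 & s] ->
  ~~ pendant e v -> exists2 u, e v u & pendant e u.
Proof.
move=> [[e_sym e_irr] _ e_ac] short vp up c2N cs us vN.
have nb : nonbacktracking (v :: p ++ [:: c1, c2 & s]).
  apply: (nonbacktracking_cat (s := v :: p)); last exact: uniq_nonbacktracking.
  apply: uniq_nonbacktracking; rewrite -cat_rcons cats1 rcons_uniq.
  exact/andP.
pose h := head c1 p; have vh : e v h.
  by rewrite /h; case: (p) vp => [|b q] /= /andP[].
have [u vu uh] := other_neighbour vN vh.
have [uP|uN] := boolP (pendant e u); first by exists u.
have uv : e u v by rewrite e_sym.
have [w uw wv] := other_neighbour uN uv.
pose t := [:: u, v & p ++ [:: c1, c2 & s]].
have wt : path e w t.
  rewrite /t -cat_rcons /= e_sym uw uv /= cat_path vp last_rcons.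
  exact: cs.
have ut : uniq (w :: t).
  apply: nonbacktracking_uniq wt _ => //.
  apply/andP; split => //.
  by rewrite /h /t in uh *; case: (p) uh nb => [|b q] /= ->.
have := short (w :: t); rewrite /simple_path [sorted _ _]wt ut => /(_ isT).
by rewrite /= size_cat /= ltnNge addnC !addnS !ltnS leq_addl.
Qed.

Lemma central_pair_sym (V : finType) (e : rel V) c1 c2 :
  symmetric e -> central_pair e c1 c2 -> central_pair e c2 c1.
Proof.
move=> e_sym [s1 [s2 [sz [/andP[ss us] longest]]]].
have revE : rev s2 ++ [:: c2, c1 & rev s1] = rev (s1 ++ [:: c1, c2 & s2]).
  by rewrite rev_cat !rev_cons -!cats1 -!catA.
exists (rev s2), (rev s1); split; first by rewrite !size_rev.
rewrite revE; split; last by move=> t /longest; rewrite size_rev.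
rewrite /simple_path rev_uniq us andbT rev_sorted.
by rewrite (eq_sorted (e' := e)) // => x y; apply: e_sym.
Qed.

Lemma support_of_path_to_central (V : finType) (e : rel V) c1 c2 v p :
  tree e -> diameter e = 5 -> central_pair e c1 c2 -> path e v (rcons p c1) ->
  uniq (v :: rcons p c1) -> c2 \notin v :: rcons p c1 ->
  ~~ pendant e v -> exists2 u, e v u & pendant e u.
Proof.
move=> T diam [s1 [s2 [sz [sp longest]]]] ep up c2N vN.
have [[e_sym _] _ e_ac] := T.
have := simple_path_size_diameter e_sym e_ac sp.
rewrite diam size_cat /= sz => size_le6; have /andP[ss us] := sp.
apply: (support_of_path_to_edge (s := s2) T _ ep up c2N) vN.
(* As [size s2 <= 2], a longest path has [2 * size s2 + 2 < size s2 + 5] vertices. *)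
- move=> t /longest; rewrite size_cat /= sz.
  by move: (size t) (size s2) size_le6; clear; lia.
- by case/cat_sorted2: ss.
- by move: us; rewrite cat_uniq => /and3P[].
Qed.

Lemma nonpendant_support (V : finType) (e : rel V) c1 c2 v :
  tree e -> diameter e = 5 -> central_pair e c1 c2 ->
  c1 \in strong_support e :|: weak_support e ->
  c2 \in strong_support e :|: weak_support e ->
  ~~ pendant e v -> exists2 u, e v u & pendant e u.
Proof.
move=> T diam cc c1s c2s vN; have [[e_sym _] [_ conn] _] := T.
have [->|vc1] := eqVneq v c1; first exact: support_pendant_neighbour.
have [->|vc2] := eqVneq v c2; first exact: support_pendant_neighbour.
have /connectP[p0 ep0 lp0] := conn v c1.
case/shortenP: ep0 lp0 => p ep up _ lp {p0}.
case/lastP: p ep up lp => [|p x] ep up.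
  by move/eqP; rewrite eq_sym (negPf vc1).
rewrite last_rcons => xE; subst x.
(* If the path to [c1] runs through [c2], its part up to [c2] avoids [c1], and the central vertices
   swap roles. *)
have [c2p|c2N] := boolP (c2 \in v :: rcons p c1); last first.
  exact: support_of_path_to_central T diam cc ep up c2N vN.
have c12 : c2 != c1.
  have [s1 [s2 [_ [/andP[_]]]]] := cc; rewrite cat_uniq => /and3P[_ _] /=.
  by rewrite inE negb_or eq_sym => /andP[/andP[]].
move: c2p ep up.
rewrite inE mem_rcons inE eq_sym (negPf vc2) (negPf c12) !orFb.
case/splitPr => q1 q2; rewrite rcons_cat rcons_cons -cat_rcons.
rewrite cat_path -cat_cons cat_uniq => /andP[ep _] /and3P[up dis _].
have c1N : c1 \notin v :: rcons q1 c2.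
  by move/hasPn: dis; apply; rewrite mem_rcons inE eqxx.
have cc' := central_pair_sym e_sym cc.
exact: support_of_path_to_central T diam cc' ep up c1N vN.
Qed.

(** Two adjacent pendant vertices would form a whole component. *)
Lemma pendant_neighbour_nonpendant (V : finType) (e : rel V) u v :
  symmetric e -> connected_graph e -> 2 < #|V| ->
  pendant e u -> e u v -> ~~ pendant e v.
Proof.
move=> e_sym conn V2 uP uv; apply/negP => vP.
have vu : e v u by rewrite e_sym.
suff : #|V| <= #|[set u; v]| by rewrite cards2; case: eqP; lia.
apply: (connected_closed_card (a := u) e_sym conn); first by rewrite !inE eqxx.
move=> x y xy; rewrite !inE => /orP[] /eqP xE; rewrite {}xE in xy.
  have := neighbours_pendant uP uv; move/setP/(_ y).
  by rewrite !inE xy => <-; rewrite orbT.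
have := neighbours_pendant vP vu; move/setP/(_ y).
by rewrite !inE xy => <-.
Qed.

(** A single summand has to be [t] itself; with two or more, all but two are set to 1 and those two
    absorb the rest [y]. *)
Lemma nonzero_int_partition (I : finType) (A : {set I}) (t : int) :
  0 < #|A| -> (#|A| = 1 -> t != 0%R) ->
  exists f : I -> int, (forall i, f i != 0%R) /\ (\sum_(i in A) f i)%R = t.
Proof.
move=> A0 tn0; have [A1|/eqP A1] := eqVneq #|A| 1.
  have [a ->] := cards1P (introT eqP A1).
  by exists (fun=> t); split; [move=> _; exact: tn0 | rewrite big_set1].
have /card_gt1P[a [b [aA bA ab]]] : 1 < #|A| by lia.
pose y := (t - \sum_(i in A :\ a :\ b) 1)%R.
(* Chosen so that both [x] and [y - x] are nonzero. *)
pose x : int := if y == 1%R then 2%R else 1%R.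
exists (fun i => if i == a then x else if i == b then (y - x)%R else 1%R).
split=> [i|].
  by rewrite /x; case: (i == a); case: (i == b) => //;
    case: (eqVneq y 1%R) => // [->|] //; rewrite subr_eq0.
rewrite (big_setD1 a) // (big_setD1 b) ?inE 1?eq_sym ?ab // !eqxx.
rewrite eq_sym (negPf ab) (eq_bigr (fun=> 1%R)).
  by rewrite /= addrA [(x + _)%R]addrC subrK subrK.
by move=> i; rewrite !inE => /and3P[/negPf -> /negPf -> _].
Qed.

(** * Magic labelings and vertices of degree 2 *)

Section Labelings.

Variables (Gamma : zmodType) (V : finType) (e : rel V).
Hypothesis (e_sym : symmetric e) (conn : connected_graph e) (V3 : 3 < #|V|).
Hypothesis support : forall v, ~~ pendant e v -> exists2 u, e v u & pendant e u.

Local Open Scope ring_scope.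

Lemma magic_degree_neq2 : vertex_magic Gamma e -> forall v, degree e v <> 2%N.
Proof.
move=> [l [l0 [mu wmu]]] v deg2.
have pendant_nbr u w : pendant e u -> e u w -> l w = mu.
  by move=> uP uw; rewrite -(wmu u) /weight (neighbours_pendant uP uw) big_set1.
have label w : ~~ pendant e w -> l w = mu.
  by case/support => u wu uP; apply: pendant_nbr uP _; rewrite e_sym.
have [u vu uP] : exists2 u, e v u & pendant e u.
  by apply: support; rewrite /pendant deg2.
have uv : e u v by rewrite e_sym.
have u_in : u \in neighbours e v by rewrite inE.
have /cards1P[w Nw] : #|neighbours e v :\ u| == 1%N.
  by move: deg2; rewrite /degree (cardsD1 u) u_in add1n => -[->].
have : w \in neighbours e v :\ u by rewrite Nw inE.
rewrite !inE => /andP[wu vw]; have wv : e w v by rewrite e_sym.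
have [wP|wN] := boolP (pendant e w).
  (* If both neighbours of [v] were pendant, the graph would be a path on three vertices. *)
  suff : (#|V| <= #|[set u; v; w]|)%N.
    rewrite leqNgt (leq_ltn_trans _ V3) // setUC cardsU1 cards2.
    by case: (_ \notin _); case: (_ != _).
  apply: (connected_closed_card (a := v) e_sym conn).
    by rewrite !inE eqxx orbT.
  move=> x y xy; rewrite !inE => /orP[/orP[]|] /eqP xE; rewrite {}xE in xy.
  - have /setP/(_ y) := neighbours_pendant uP uv.
    by rewrite !inE xy => <-; rewrite orbT.
  - have /setP/(_ y) := Nw; rewrite !inE xy andbT => <-.
    by case: eqP => //; rewrite orbT.
  - have /setP/(_ y) := neighbours_pendant wP wv.
    by rewrite !inE xy => <-; rewrite orbT.
have := wmu v; rewrite /weight (big_setD1 u) // Nw big_set1 (label _ wN).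
by move=> /= /eqP; rewrite -[eqbRHS]add0r (inj_eq (addIr mu)) (negPf (l0 u)).
Qed.

Lemma degree_neq2_magic :
  ~ torsion_group Gamma -> (forall v, degree e v <> 2%N) ->
  vertex_magic Gamma e.
Proof.
move=> ntors deg.
have [g g_tf] : exists g : Gamma, forall z : int, g *~ z = 0 -> z = 0.
  have [g gP] := not_all_ex_not _ _ ntors; exists g => -[[//|n]|n] gn.
    by case: gP; exists n.+1.
  by case: gP; exists n.+1 => //; apply: oppr_inj; rewrite oppr0 -gn.
pose N v := neighbours e v; pose P v := pendant_neighbours e v.
have /fin_all_exists[F FP] v : exists f : V -> int, (forall u, f u != 0) /\
    (~~ pendant e v -> \sum_(u in P v) f u = 1 - #|N v :\: P v|%:Z).
  have [vP|vN] := boolP (pendant e v).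
    by exists (fun=> 1).
  have [||f [f0 sf]] :=
    @nonzero_int_partition _ (P v) (1 - #|N v :\: P v|%:Z).
  - by have [u vu uP] := support vN; apply/card_gt0P; exists u; rewrite !inE vu.
  (* With one pendant neighbour, the target vanishes only if there is exactly one other neighbour,
     that is, in degree 2. *)
  - have := deg v; rewrite /degree -(cardsID (P v)) (setIidPr _) -/(N v).
      by move=> degv P1; apply/eqP; lia.
    by apply/subsetP => u; rewrite !inE => /andP[].
  by exists f.
(* For pendant [u] the sum has one term; it stands for the value at the unique neighbour of [u]. *)
pose l u := if pendant e u then \sum_(v in N u) g *~ F v u else g.
have l_pendant u v : pendant e u -> e u v -> l u = g *~ F v u.
  by move=> uP uv; rewrite /l uP /N (neighbours_pendant uP uv) big_set1.
exists l; split.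
  move=> u; have [uP|uN] := boolP (pendant e u); last first.
    by rewrite /l (negPf uN); apply/eqP => g0; have := g_tf 1 g0.
  have /card_gt0P[v] : (0 < degree e u)%N by rewrite (eqP uP).
  rewrite inE => uv; rewrite (l_pendant _ _ uP uv).
  by apply/eqP => /g_tf/eqP; apply/negP; case: (FP v).
exists g => v; rewrite /weight; have [vP|vN] := boolP (pendant e v).
  have /card_gt0P[u] : (0 < degree e v)%N by rewrite (eqP vP).
  rewrite inE => vu; rewrite (neighbours_pendant vP vu) big_set1 /l.
  have := pendant_neighbour_nonpendant e_sym conn (ltnW V3) vP vu.
  by move/negPf->.
(* With [n] non-pendant neighbours, the pendant ones contribute [(1 - n) g] and the others [n g]. *)
rewrite (big_setID (P v)) (setIidPr _) /=; last first.
  by apply/subsetP => u; rewrite !inE => /andP[].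
rewrite (eq_bigr (fun u => g *~ F v u)); last first.
  by move=> u; rewrite !inE => /andP[vu uP]; apply: l_pendant; rewrite // e_sym.
rewrite [X in _ + X](eq_bigr (fun=> g)); last first.
  by move=> u; rewrite /l !inE => /andP[+ vu]; rewrite vu /= => /negPf->.
rewrite sumr_const -mulrz_sumr (proj2 (FP v) vN) pmulrn -mulrzDr.
by rewrite subrK.
Qed.

End Labelings.

Theorem theorem4p5 (Gamma : zmodType) (V : finType) (e : rel V) (c1 c2 : V) :
  infinite_group Gamma ->
  ~ torsion_group Gamma ->
  tree e ->
  diameter e = 5 ->
  central_pair e c1 c2 ->
  c1 \in strong_support e :|: weak_support e ->
  c2 \in strong_support e :|: weak_support e ->
  vertex_magic Gamma e <-> ~ exists v : V, degree e v = 2.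
Proof.
move=> _ ntors T diam cc c1s c2s; have [[e_sym _] conn _] := T.
have support v := @nonpendant_support _ _ _ _ v T diam cc c1s c2s.
have V3 : 3 < #|V|.
  by have := diameter_le_card e; rewrite diam; apply: leq_trans.
split=> [magic [v]|deg]; first exact: magic_degree_neq2 magic v.
by apply: degree_neq2_magic => // v deg2; apply: deg; exists v.
Qed.
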